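(* Let $R$ be a commutative finite chain ring of nilpotency index $e$ and residue field $\mathbb{F}_q$, and let $\gamma$ be a generator of the maximal ideal of $R$. Then \[d_n(R,\gamma^s)=q^{(e-1)(n-1)}(q-1)^{n-1}\binom{n+s-1}{n-1}\] for all integers $1\leq s<e$ and for all positive integers $n$.
   Context: A commutative finite chain ring (CFCR) is a finite commutative ring $R$ with identity $1\neq 0$ whose ideals are linearly ordered by inclusion. Its unique maximal ideal is principal; for a generator $\gamma$ of it, the nilpotency index of $R$ is the smallest positive integer $e$ with $\gamma^e=0$, and the residue field is $R/\gamma R\cong\mathbb{F}_q$ for a prime power $q$. For a commutative ring $S$, $n\in\mathbb{N}$ and $a\in S$, $d_n(S,a)$ denotes the number of $n\times n$ diagonal matrices over $S$ with determinant $a$. *)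

(* Defs.v *)
From HB Require Import structures.
From mathcomp Require Import all_boot all_order all_fingroup all_algebra.
From mathcomp Require Import finalg ring_quotient.

Set Implicit Arguments.
Unset Strict Implicit.
Unset Printing Implicit Defensive.

Import GRing.Theory.
Local Open Scope ring_scope.

(* The library's [idealr] covers proper ideals only; here the whole ring is an
   ideal too. Closure under opposites is the case a = -1. *)
Definition is_ideal (R : finComNzRingType) (I : {set R}) : Prop :=
  [/\ 0 \in I,
      {in I &, forall x y, x + y \in I}
    & forall a : R, {in I, forall x, a * x \in I}].

Definition maximal_ideal (R : finComNzRingType) (M : {set R}) : Prop :=
  [/\ is_ideal M,
      M != [set: R]
    & forall J : {set R}, is_ideal J -> M \subset J -> J = M \/ J = [set: R]].

Definition principal_ideal (R : finComNzRingType) (g : R) : {set R} :=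
  [set g * x | x : R].

Definition finite_chain_ring (R : finComNzRingType) : Prop :=
  forall I J : {set R}, is_ideal I -> is_ideal J -> I \subset J \/ J \subset I.

Definition max_ideal_generator (R : finComNzRingType) (g : R) : Prop :=
  maximal_ideal (principal_ideal g).

Definition nilpotency_index (R : finComNzRingType) (e : nat) : Prop :=
  exists2 g : R, max_ideal_generator g &
    [/\ (0 < e)%N, g ^+ e = 0
      & forall k : nat, (0 < k)%N -> g ^+ k = 0 -> (e <= k)%N].

(* R / gR is isomorphic to a finite field with q elements, for a generator g
   of the maximal ideal; M is gR packaged as a library ideal, so that the
   library quotient ring can be formed. *)
Definition residue_field_order (R : finComNzRingType) (q : nat) : Prop :=
  exists (g : R) (M : idealr R) (F : finFieldType)
         (f : {rmorphism {ideal_quot M} -> F}),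
    [/\ max_ideal_generator g, M =i principal_ideal g, bijective f
      & #|F| = q].

Definition num_diag_det (n : nat) (S : finComNzRingType) (a : S) : nat :=
  #|[set A : 'M[S]_n | is_diag_mx A && (\det A == a)]|.

(* Main.v *)
Require Import Defs.
From HB Require Import structures.
From mathcomp Require Import all_boot all_order all_fingroup all_algebra.
From mathcomp Require Import finalg ring_quotient.
From mathcomp Require Import zify.

(** Every element is a unit times [gamma ^ k] for a unique valuation [k <= e],
    and valuations add under multiplication as long as the sum stays below [e].
    There are [q ^ (e - 1 - t) * (q - 1)] elements of valuation [t < e], so every
    way of writing [s] as an ordered sum of [n] valuations is realised by
    [q ^ ((e - 1) * n - s) * (q - 1) ^ n] tuples, and there are
    ['C(n + s - 1, n - 1)] such ways.  The products of these tuples are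
    equidistributed over the [q ^ (e - 1 - s) * (q - 1)] associates of
    [gamma ^ s], since multiplying one entry by a unit permutes the tuples. *)

Set Implicit Arguments.
Unset Strict Implicit.
Unset Printing Implicit Defensive.

Import GRing.Theory.
Local Open Scope ring_scope.

(** * Counting with additive maps and principal ideals *)

Lemma card_additive_image (U V : finZmodType) (f : {additive U -> V})
    (A : {set U}) :
    {in A &, forall x y, x + y \in A} -> {in A &, forall x y, x - y \in A} ->
  #|A| = (#|f @: A| * #|[set x in A | f x == 0%R]|)%N.
Proof.
move=> AD AB; rewrite -sum1_card (partition_big_imset f) /=.
rewrite (eq_bigr (fun=> #|[set x in A | f x == 0%R]|)) ?sum_nat_const //.
move=> _ /imsetP[a aA ->]; rewrite sum1dep_card.
(* Translation by [- a] carries the fibre of [f] through [a] onto the kernel part of [A]. *)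
rewrite -(card_imset _ (addIr (- a))); apply: eq_card => x.
rewrite !inE; apply/imsetP/andP => [[y] | [xA /eqP fx]].
  rewrite inE => /andP[yA /eqP fy] ->.
  by rewrite AB // raddfB fy subrr eqxx.
exists (x + a); last by rewrite addrK.
by rewrite inE AD //= raddfD fx add0r eqxx.
Qed.

Section PrincipalIdeals.
Variables (R : finComNzRingType) (g : R).

Lemma mem_principal_ideal (x : R) :
  reflect (exists y, x = g * y) (x \in principal_ideal g).
Proof.
by apply: (iffP imsetP) => [[y _ ->] | [y ->]]; exists y.
Qed.

Lemma principal_ideal_is_ideal : is_ideal (principal_ideal g).
Proof.
split=> [|_ _ /mem_principal_ideal[x ->] /mem_principal_ideal[y ->]|
  a _ /mem_principal_ideal[x ->]]; apply/mem_principal_ideal.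
- by exists 0; rewrite mulr0.
- by exists (x + y); rewrite mulrDr.
- by exists (a * x); rewrite mulrCA.
Qed.

Lemma mul_principal_ideal (x y : R) :
  x \in principal_ideal g -> y * x \in principal_ideal g.
Proof. by case: principal_ideal_is_ideal => _ _; apply. Qed.

Lemma principal_idealD (x y : R) :
    x \in principal_ideal g -> y \in principal_ideal g ->
  x + y \in principal_ideal g.
Proof. by case: principal_ideal_is_ideal => _ gD _; apply: gD. Qed.

Lemma principal_idealB (x y : R) :
    x \in principal_ideal g -> y \in principal_ideal g ->
  x - y \in principal_ideal g.
Proof.
by move=> xg yg; rewrite principal_idealD // -mulN1r mul_principal_ideal.
Qed.

End PrincipalIdeals.

(** * Units, nilpotency and residue field in terms of an arbitrary generator *)

Section ChainRing.
Variable R : finComNzRingType.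
Hypothesis chainR : finite_chain_ring R.

(** Two maximal ideals are comparable in a chain ring. This transfers what the definitions of [e]
    and [q] assert of some generator to the given one. *)
Lemma max_ideal_generator_unique (g h : R) :
  max_ideal_generator g -> max_ideal_generator h ->
  principal_ideal g = principal_ideal h.
Proof.
move=> [gI g1 gmax] [hI h1 hmax]; have [gh | hg] := chainR gI hI.
  by have [-> // | hT] := gmax _ hI gh; rewrite hT eqxx in h1.
by have [-> // | gT] := hmax _ gI hg; rewrite gT eqxx in g1.
Qed.

(** The ideal of [x] is comparable with that of [g] and not inside it, so it strictly contains a
    maximal ideal. *)
Lemma notin_max_ideal_unit (g x : R) :
  max_ideal_generator g -> x \notin principal_ideal g -> exists y, x * y = 1.
Proof.
move=> [gI _ gmax] xNg; have xI := principal_ideal_is_ideal x.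
have xx : x \in principal_ideal x.
  by apply/mem_principal_ideal; exists 1; rewrite mulr1.
have [xg | gx] := chainR xI gI; first by rewrite (subsetP xg) in xNg.
have [xg | xT] := gmax _ xI gx; first by rewrite -xg xx in xNg.
have: 1 \in principal_ideal x by rewrite xT inE.
by case/mem_principal_ideal=> y ->; exists y.
Qed.

(** Generators of the maximal ideal divide each other, so their powers vanish together. *)
Lemma max_ideal_generator_expr_eq0 (e k : nat) (g : R) :
    nilpotency_index R e -> max_ideal_generator g ->
  (g ^+ k == 0) = (e <= k)%N.
Proof.
move=> [h hmax [e_gt0 he mine]] gmax.
have hg := max_ideal_generator_unique hmax gmax.
have mem1 (x : R) : x \in principal_ideal x.
  by apply/mem_principal_ideal; exists 1; rewrite mulr1.
have /mem_principal_ideal[a hE] : h \in principal_ideal g by rewrite -hg.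
have /mem_principal_ideal[b gE] : g \in principal_ideal h by rewrite hg.
apply/eqP/idP => [gk0 | ek].
  have k_gt0 : (0 < k)%N.
    by case: k gk0 => // /eqP; rewrite expr0 oner_eq0.
  by apply: mine => //; rewrite hE exprMn gk0 mul0r.
by rewrite -(subnKC ek) exprD gE exprMn he !mul0r.
Qed.

Lemma card_max_ideal_index (q : nat) (g : R) :
    residue_field_order R q -> max_ideal_generator g ->
  #|R| = (q * #|principal_ideal g|)%N.
Proof.
move=> [h [M [F [f [hmax Mh fbij <-]]]]] gmax.
pose p : {additive R -> F} := f \o (\pi_{ideal_quot M})%qT.
rewrite -cardsT (card_additive_image p); try by move=> *; rewrite inE.
congr (_ * _)%N.
  rewrite -cardsT; apply: eq_card => z; rewrite inE; apply/imsetP.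
  case: fbij => f' f'K fK; exists (generic_quotient.repr (f' z)) => //=.
  by rewrite reprK fK.
rewrite (max_ideal_generator_unique gmax hmax); apply: eq_card => x.
rewrite inE in_setT -Mh -[x in RHS]subr0 Quotient.idealrBE /=.
by rewrite -(rmorph0 f) (inj_eq (bij_inj fbij)) -(rmorph0 (\pi_{ideal_quot M})%qT).
Qed.

End ChainRing.

(** * The valuation attached to the powers of [g] *)

Section Valuation.
Variables (R : finComNzRingType) (g : R) (e : nat).
Hypothesis unit_notin : forall x, x \notin principal_ideal g -> exists y, x * y = 1.
Hypothesis expg_eq0 : forall k, (g ^+ k == 0) = (e <= k)%N.

Local Notation P k := (principal_ideal (g ^+ k)).

(* Elements of the ideal generated by [g ^+ e], i.e. 0, get valuation [e]. *)
Definition valuation (a : R) : nat := \max_(k < e.+1 | a \in P k) k.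

Lemma expr_index : g ^+ e = 0.
Proof. by apply/eqP; rewrite expg_eq0. Qed.

Lemma one_notin_max_ideal : 1 \notin principal_ideal g.
Proof.
apply/mem_principal_ideal => -[y gy].
have /eqP := expr1n R e.
by rewrite [X in X ^+ e]gy exprMn expr_index mul0r eq_sym oner_eq0.
Qed.

Lemma principal_ideal_expr_anti i j : (i <= j)%N -> P j \subset P i.
Proof.
move=> ij; apply/subsetP => _ /mem_principal_ideal[x ->].
by apply/mem_principal_ideal; exists (g ^+ (j - i) * x);
  rewrite mulrA -exprD subnKC.
Qed.

Lemma mul_notin_max_ideal x y :
  x \notin principal_ideal g -> y \notin principal_ideal g ->
  x * y \notin principal_ideal g.
Proof.
move=> /unit_notin[x' xx'] /unit_notin[y' yy'].
apply: contra one_notin_max_ideal => xyg.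
by rewrite -xx' -[x]mulr1 -yy' mulrA -mulrA mulrC mul_principal_ideal.
Qed.

(** Otherwise [g ^+ k] equals [g ^+ k] times a multiple of [g]; iterating [e] times forces
    [g ^+ k = 0], against [k < e]. *)
Lemma expr_mul_notin k x :
  (k < e)%N -> x \notin principal_ideal g -> g ^+ k * x \notin P k.+1.
Proof.
move=> ke /unit_notin[y xy]; apply/mem_principal_ideal => -[z gxz].
have gk m : g ^+ k = g ^+ k * (g * z * y) ^+ m.
  elim: m => [|m IHm]; first by rewrite mulr1.
  by rewrite exprSr mulrA -IHm !mulrA -exprSr -gxz -mulrA xy mulr1.
have := expg_eq0 k; rewrite leqNgt ke (gk e) !exprMn expr_index.
by rewrite !mul0r mulr0 eqxx.
Qed.

Lemma valuation_le a : (valuation a <= e)%N.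
Proof. by apply/bigmax_leqP => i _; rewrite -ltnS. Qed.

Lemma leq_valuation a k : (k <= e)%N -> (k <= valuation a)%N = (a \in P k).
Proof.
rewrite -ltnS => ke; apply/idP/idP => [kv | aP]; last first.
  exact: (leq_bigmax_cond (Ordinal ke)).
apply: (subsetP (principal_ideal_expr_anti kv)).
have aP0 : a \in P (ord0 : 'I_e.+1).
  by apply/mem_principal_ideal; exists a; rewrite expr0 mul1r.
rewrite /valuation (@bigmax_eq_arg _ _ (fun k : 'I_e.+1 => a \in P k) _ aP0).
by case: arg_maxnP.
Qed.

Lemma valuation_factor a :
  exists2 x, x \notin principal_ideal g & a = g ^+ valuation a * x.
Proof.
have := leq_valuation a (valuation_le a); rewrite leqnn => /esym.
case/mem_principal_ideal=> x aE.
have [ve | ve] := ltnP (valuation a) e; last first.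
  (* Here [a] is 0, so any cofactor outside the ideal serves. *)
  exists 1; first exact: one_notin_max_ideal.
  have /eqP ge : g ^+ valuation a == 0 by rewrite expg_eq0.
  by rewrite {1}aE ge !mul0r.
exists x => //; have := leq_valuation a ve; rewrite ltnn => /esym/negbT.
apply: contra => /mem_principal_ideal[y xy]; apply/mem_principal_ideal.
by exists y; rewrite {1}aE xy mulrA -exprSr.
Qed.

Lemma valuation_expr_mul k x : x \notin principal_ideal g ->
  valuation (g ^+ k * x) = minn e k.
Proof.
move=> xNg; have [ke | ek] := ltnP k e; last first.
  apply/eqP; rewrite eqn_leq valuation_le leq_valuation //.
  have /eqP -> : g ^+ k == 0 by rewrite expg_eq0.
  by rewrite mul0r; case: (principal_ideal_is_ideal (g ^+ e)).
apply/eqP; rewrite eqn_leq leqNgt leq_valuation // expr_mul_notin //=.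
by rewrite leq_valuation 1?ltnW //; apply/mem_principal_ideal; exists x.
Qed.

Lemma valuation1 : valuation 1 = 0%N.
Proof.
by rewrite -(mul1r 1) -(expr0 g) valuation_expr_mul ?minn0 ?one_notin_max_ideal.
Qed.

Lemma valuationM a b : valuation (a * b) = minn e (valuation a + valuation b).
Proof.
have [x xNg aE] := valuation_factor a; have [y yNg bE] := valuation_factor b.
rewrite {1}aE {1}bE mulrACA -exprD.
by rewrite valuation_expr_mul ?mul_notin_max_ideal.
Qed.

Lemma valuation_prod (I : finType) (F : I -> R) :
  valuation (\prod_i F i) = minn e (\sum_i valuation (F i)).
Proof.
elim/big_ind2: _ => [|m a n b Ha Hb|i _]; first by rewrite valuation1 minn0.
- by rewrite valuationM Ha Hb; lia.
- by apply/esym/minn_idPr/valuation_le.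
Qed.

(** * Equidistribution of products over associates *)

Definition num_prod (I : finType) (a : R) : nat :=
  #|[set f : {ffun I -> R} | \prod_i f i == a]|.

(** Scaling the entry at [i0] by the unit [x] is injective on families and multiplies the product by
    [x]. *)
Lemma leq_num_prod_unit (I : finType) (i0 : I) (x y a : R) :
  x * y = 1 -> (num_prod I a <= num_prod I (x * a)%R)%N.
Proof.
move=> xy; pose h (f : {ffun I -> R}) :=
  [ffun i => (if i == i0 then x else 1) * f i].
have h_inj : injective h.
  move=> f1 f2 /ffunP eqf; apply/ffunP => i.
  have := eqf i; rewrite !ffunE; case: (i == i0); last by rewrite !mul1r.
  by move/(congr1 ( *%R y)); rewrite !mulrA (mulrC y) xy !mul1r.
rewrite /num_prod -(card_imset _ h_inj).
apply/subset_leq_card/subsetP => b /imsetP[f]; rewrite !inE => /eqP fa {b}->.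
under eq_bigr do rewrite ffunE.
by rewrite big_split /= fa -big_mkcond big_pred1_eq.
Qed.

Lemma num_prod_valuation (I : finType) (i0 : I) (a : R) :
  num_prod I a = num_prod I (g ^+ valuation a).
Proof.
have [x /unit_notin[y xy] aE] := valuation_factor a.
apply/eqP; rewrite eqn_leq; apply/andP; split; last first.
  by rewrite {2}aE mulrC (leq_num_prod_unit i0 _ xy).
have yx : y * x = 1 by rewrite mulrC.
by apply: leq_trans (leq_num_prod_unit i0 a yx) _; rewrite {1}aE mulrCA yx mulr1.
Qed.

(** * Cardinalities of ideals, valuation classes and families *)

Variable q : nat.
Hypothesis card_index : #|R| = (q * #|principal_ideal g|)%N.

(* Multiplication by [g ^+ k] has the same kernel on [R] and on the maximal
   ideal, because an annihilator of [g ^+ k != 0] is not a unit. *)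
Lemma card_principal_ideal_exprS k :
  (k < e)%N -> #|P k| = (q * #|P k.+1|)%N.
Proof.
move=> ke; pose f : {additive R -> R} := GRing.mull_fun (g ^+ k) idfun.
pose K := [set x | f x == 0].
have K_gt0 : (0 < #|K|)%N.
  by apply/card_gt0P; exists 0; rewrite inE raddf0.
have cardT : #|R| = (#|P k| * #|K|)%N.
  rewrite -cardsT (card_additive_image f); try by move=> *; rewrite inE.
  congr (_ * _)%N; last by apply: eq_card => x; rewrite !inE.
  apply: eq_card => x; apply/imsetP/mem_principal_ideal => [[y _ ->]|[y ->]].
    by exists y.
  by exists y; rewrite ?inE.
have cardM : #|principal_ideal g| = (#|P k.+1| * #|K|)%N.
  rewrite (card_additive_image f); first congr (_ * _)%N.
  - apply: eq_card => x; apply/imsetP/mem_principal_ideal.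
      by case=> _ /mem_principal_ideal[y ->] ->; exists y; rewrite exprSr -mulrA.
    case=> y ->; exists (g * y); last by rewrite exprSr -mulrA.
    by apply/mem_principal_ideal; exists y.
  - apply: eq_card => x; rewrite !inE andb_idl //.
    apply: contraTT => xNg; apply: contra (expr_mul_notin ke xNg) => /eqP/= ->.
    by case: (principal_ideal_is_ideal (g ^+ k.+1)).
  - by move=> x y; apply: principal_idealD.
  - by move=> x y; apply: principal_idealB.
by apply/eqP; rewrite -(eqn_pmul2r K_gt0) -mulnA -cardM -cardT card_index.
Qed.

Lemma card_principal_ideal_expr k : (k <= e)%N -> #|P (e - k)| = (q ^ k)%N.
Proof.
elim: k => [_|k IHk ke].
  rewrite subn0 expr_index (_ : principal_ideal 0 = [set 0]) ?cards1 //.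
  apply/setP=> x; rewrite inE; apply/mem_principal_ideal/eqP => [[y ->]|->].
    by rewrite mul0r.
  by exists 0; rewrite mul0r.
rewrite card_principal_ideal_exprS; last by rewrite -subn_gt0; lia.
by rewrite -subSn // subSS IHk 1?ltnW // expnS.
Qed.

(** The factor [q ^ k] makes the right-hand side independent of [k], so that the classes can be
    multiplied together uniformly. *)
Lemma card_valuation k : (k < e)%N ->
  (#|[set a | valuation a == k]| * q ^ k = q ^ (e - 1) * (q - 1))%N.
Proof.
move=> ke; have PS := principal_ideal_expr_anti (leqnSn k).
have -> : [set a | valuation a == k] = P k :\: P k.+1.
  apply/setP => a; rewrite !inE -(leq_valuation a ke) -(leq_valuation a (ltnW ke)).
  by rewrite -leqNgt eqn_leq.
rewrite cardsD (setIidPr PS) card_principal_ideal_exprS //.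
have -> : (k.+1 = e - (e - k.+1))%N by lia.
rewrite card_principal_ideal_expr; last by lia.
rewrite -[X in (_ - X)%N]mul1n -mulnBl -mulnA -expnD mulnC; congr (q ^ _ * _)%N.
by lia.
Qed.

Lemma card_sum_valuation m s : (s < e)%N ->
  (#|[set f : {ffun 'I_m.+1 -> R} | \sum_i valuation (f i) == s]%N| * q ^ s
   = (q ^ (e - 1) * (q - 1)) ^ m.+1 * 'C(m + s, m))%N.
Proof.
move=> se; rewrite -sum1dep_card.
(* The default value of [inord] never occurs: when the valuations sum to [s], each is at most
   [s]. *)
pose t (f : {ffun 'I_m.+1 -> R}) : m.+1.-tuple 'I_s.+1 :=
  [tuple inord (valuation (f i)) | i < m.+1].
have val_le (f : {ffun 'I_m.+1 -> R}) i :
  (\sum_i valuation (f i))%N == s -> (valuation (f i) <= s)%N.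
  by move=> /eqP <-; rewrite (bigD1 i) //= leq_addr.
rewrite (partition_big t (fun u => \sum_(i <- u) i == s)%N); last first.
  move=> f fs; rewrite big_tuple; apply/eqP/(etrans _ (eqP fs))/eq_bigr => i _.
  by rewrite tnth_mktuple inordK // ltnS val_le.
rewrite big_distrl /=.
rewrite (eq_bigr (fun=> (q ^ (e - 1) * (q - 1)) ^ m.+1)%N); last first.
  move=> u; rewrite big_tuple => /eqP us; rewrite sum1dep_card.
  pose F (i : 'I_m.+1) : {set R} := [set a | valuation a == tnth u i].
  have -> : #|[set f : {ffun 'I_m.+1 -> R} |
       ((\sum_i valuation (f i))%N == s) && (t f == u)]| = #|family F|.
    apply: eq_card => f; rewrite !inE; apply/andP/familyP => [[fs /eqP tu] i|fF].
      by rewrite inE -tu tnth_mktuple inordK // ltnS val_le.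
    have {}fF i : valuation (f i) = tnth u i by have := fF i; rewrite inE => /eqP.
    split; first by apply/eqP/(etrans _ us)/eq_bigr.
    by apply/eqP/eq_from_tnth => i; rewrite tnth_mktuple fF inord_val.
  rewrite card_family foldrE big_map big_enum /=.
  (* Splitting [q ^ s] along [u] gives each entry the factor that [card_valuation] requires. *)
  have -> : (q ^ s = \prod_i q ^ tnth u i)%N by rewrite -expn_sum us.
  rewrite -big_split /= (eq_bigr (fun=> q ^ (e - 1) * (q - 1)))%N.
    by rewrite prod_nat_const card_ord.
  by move=> i _; rewrite card_valuation //; apply: leq_ltn_trans se; rewrite -ltnS.
by rewrite sum_nat_const -card_ord_partitions cardsE mulnC.
Qed.

(** Families with valuations summing to [s] are counted again by their product; comparison with
    [card_sum_valuation] leaves one factor [q ^ (e - 1) * (q - 1)] to cancel, which is positive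
    since [1 < q]. *)
Lemma num_prod_expr m s : (1 < q)%N -> (s < e)%N ->
  num_prod 'I_m.+1 (g ^+ s)
    = (q ^ ((e - 1) * m) * (q - 1) ^ m * 'C(m + s, m))%N.
Proof.
move=> q_gt1 se; have cs := card_valuation se.
have c_gt0 : (0 < q ^ (e - 1) * (q - 1))%N.
  by rewrite muln_gt0 expn_gt0 subn_gt0 q_gt1 (ltnW q_gt1).
have cE : #|[set f : {ffun 'I_m.+1 -> R} | \sum_i valuation (f i) == s]%N|
  = (#|[set a | valuation a == s]| * num_prod 'I_m.+1 (g ^+ s))%N.
  rewrite -[LHS]sum1dep_card.
  rewrite (partition_big (fun f : {ffun 'I_m.+1 -> R} => \prod_i f i)
            [pred a | valuation a == s]) /=; last first.
    by move=> f /eqP fs; rewrite valuation_prod fs; apply/eqP/minn_idPr/ltnW.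
  rewrite (eq_bigr (fun=> num_prod 'I_m.+1 (g ^+ s))).
    by rewrite sum_nat_const cardsE.
  move=> a /eqP as_; rewrite sum1dep_card -as_ -(num_prod_valuation ord0).
  apply: eq_card => f; rewrite !inE andb_idl // => /eqP fa.
  (* A product of valuation below [e] is not truncated, so the valuations of its factors sum exactly
     to [s]. *)
  have := se; rewrite -as_ -fa valuation_prod gtn_min ltnn /=.
  by move=> /ltnW/minn_idPr ->.
have := card_sum_valuation m se; rewrite cE mulnAC cs expnS -[RHS]mulnA => /eqP.
by rewrite eqn_pmul2l // expnMn -expnM => /eqP.
Qed.

End Valuation.

(** * From diagonal matrices to families of diagonal entries *)

Lemma num_diag_detE (R : finComNzRingType) n (a : R) :
  num_diag_det n a = num_prod 'I_n a.
Proof.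
pose d (f : {ffun 'I_n -> R}) := diag_mx (\row_i f i).
have d_inj : injective d.
  move=> f1 f2 /matrixP eqd; apply/ffunP => i.
  by have := eqd i i; rewrite !mxE eqxx.
rewrite /num_prod -(card_imset _ d_inj); apply: eq_card => A.
rewrite inE; apply/andP/imsetP => [[/diag_mxP[r ->]]|[f]].
  rewrite det_diag => /eqP ra; exists [ffun i => r 0 i].
    by rewrite inE -ra; apply/eqP/eq_bigr => i _; rewrite ffunE.
  by congr diag_mx; apply/rowP => i; rewrite mxE ffunE.
rewrite inE => /eqP fa ->; split; first by apply/diag_mxP; exists (\row_i f i).
by rewrite det_diag -fa; apply/eqP/eq_bigr => i _; rewrite mxE.
Qed.

Local Close Scope ring_scope.

Theorem theorem3p9 (R : finComNzRingType) (e q : nat) (gamma : R)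
    (hR : finite_chain_ring R)
    (he : nilpotency_index R e)
    (hq : residue_field_order R q)
    (hgamma : max_ideal_generator gamma)
    (s n : nat) (hs1 : 1 <= s) (hse : s < e) (hn : 0 < n) :
  num_diag_det n (gamma ^+ s)%R =
    q ^ ((e - 1) * (n - 1)) * (q - 1) ^ (n - 1) * 'C(n + s - 1, n - 1).
Proof.
have q_gt1 : 1 < q.
  by case: hq => [g [M [F [f [_ _ _ <-]]]]]; exact: card_finNzRing_gt1.
(* Writing [n] as [m.+1] removes the truncated subtractions from [n - 1] and [n + s - 1]. *)
case: n hn => // m _; rewrite num_diag_detE addSn !subSS !subn0.
apply: num_prod_expr => // [x | k |].
- exact: notin_max_ideal_unit.
- exact: max_ideal_generator_expr_eq0.
- exact: card_max_ideal_index.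
Qed.
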